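(* Let $A$ be a two-sided skew brace whose multiplicative group $(A,\circ)$ is nilpotent. Then its additive group $(A,+)$ is abelian-by-nilpotent and nilpotent-by-abelian.
   Context: A skew (left) brace is a triple $(A,+,\circ)$ such that $(A,+)$ and $(A,\circ)$ are (not necessarily abelian) groups and $a\circ(b+c)=a\circ b-a+a\circ c$ for all $a,b,c\in A$. It is two-sided if moreover $(a+b)\circ c=a\circ c-c+b\circ c$ for all $a,b,c\in A$. A group is abelian-by-nilpotent if it has an abelian normal subgroup with nilpotent quotient, and nilpotent-by-abelian if it has a nilpotent normal subgroup with abelian quotient. *)

(* Defs.v *)
From HB Require Import structures.
From mathcomp Require Import all_boot boolp.

Set Implicit Arguments.
Unset Strict Implicit.
Unset Printing Implicit Defensive.

Local Open Scope group_scope.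
Local Open Scope quotient_scope.

(* Groups are possibly infinite, hence [groupType] and [groupClosed] rather
   than [finGroupType] and [{group gT}]. *)

HB.mixin Record isNormalClosed (G : groupType) (S : {pred G}) := {
  gpredJr : forall x g : G, x \in S -> x ^ g \in S
}.

#[short(type="normalClosed")]
HB.structure Definition NormalClosed (G : groupType) :=
  {S of GroupClosed G S & isNormalClosed G S}.

Section Subgroups.
Variable G : groupType.
Implicit Types S H : {pred G}.

Definition generated S : {pred G} :=
  [pred x | `[< forall K : groupClosed G, {subset S <= K} -> x \in K >]].

Definition commutator S H : {pred G} :=
  generated [pred z | `[< exists x y, [/\ x \in S, y \in H & z = [~ x, y]] >]].

(* Indexed from 0: [lower_central H 0] is H itself. *)
Fixpoint lower_central H n : {pred G} :=
  if n is m.+1 then commutator (lower_central H m) H else H.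

Definition nilpotent H := exists n, {subset lower_central H n <= pred1 1}.

Definition abelian H := {in H &, commutative mul}.

End Subgroups.

Section Quotient.
Variables (G : groupType) (N : normalClosed G).
Implicit Types x y z : G.

Definition coset_rel : rel G := fun x y => x^-1 * y \in N.

Lemma coset_rel_equiv : equiv_class_of coset_rel.
Proof.
split=> [x | x y | y x z]; rewrite /coset_rel.
- by rewrite mulVg gpred1.
- by rewrite -gpredV invgM invgK.
- by move=> xy yz; rewrite -(mulgK y x^-1) -mulgA gpredM.
Qed.

Canonical coset_equiv := EquivRelPack coset_rel_equiv.

Definition quotient := {eq_quot coset_equiv}.
HB.instance Definition _ := Choice.on quotient.

Lemma quotient_piP x y :
  reflect (\pi_quotient x = \pi_quotient y) (x^-1 * y \in N).
Proof. by apply: (iffP idP) => [?|/eqmodP//]; apply/eqmodP. Qed.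

Definition quotient_one : quotient := \pi_quotient 1.
Definition quotient_mul (u v : quotient) : quotient :=
  \pi_quotient (repr u * repr v).
Definition quotient_inv (u : quotient) : quotient :=
  \pi_quotient (repr u)^-1.

Lemma quotient_mul_pi x y :
  quotient_mul (\pi_quotient x) (\pi_quotient y) = \pi_quotient (x * y).
Proof.
rewrite /quotient_mul; apply/quotient_piP.
have Nx : x^-1 * repr (\pi_quotient x) \in N.
  by apply/quotient_piP; rewrite reprK.
have Ny : y^-1 * repr (\pi_quotient y) \in N.
  by apply/quotient_piP; rewrite reprK.
set x' := repr _ in Nx *; set y' := repr _ in Ny *.
rewrite -gpredV invgM invgK [(x * y)^-1]invgM -mulgA.
have -> : y^-1 * (x^-1 * (x' * y')) = (x^-1 * x') ^ y * (y^-1 * y').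
  by rewrite conjgE !mulgA mulgK.
by rewrite gpredM ?gpredJr.
Qed.

Lemma quotient_inv_pi x : quotient_inv (\pi_quotient x) = \pi_quotient x^-1.
Proof.
rewrite /quotient_inv; apply/quotient_piP.
have Nx : x^-1 * repr (\pi_quotient x) \in N.
  by apply/quotient_piP; rewrite reprK.
set x' := repr _ in Nx *.
have -> : x'^-1^-1 * x^-1 = (x^-1 * x') ^ x^-1.
  by rewrite conjgE !invgK !mulgA mulgV mul1g.
by rewrite gpredJr.
Qed.

Let quotient_mulA : associative quotient_mul.
Proof.
elim/quotW=> x; elim/quotW=> y; elim/quotW=> z.
by rewrite (quotient_mul_pi y z) (quotient_mul_pi x y) !quotient_mul_pi mulgA.
Qed.

Let quotient_mul1 : left_id quotient_one quotient_mul.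
Proof. by elim/quotW=> x; rewrite quotient_mul_pi mul1g. Qed.

Let quotient_mulr1 : right_id quotient_one quotient_mul.
Proof. by elim/quotW=> x; rewrite quotient_mul_pi mulg1. Qed.

Let quotient_mulV : left_inverse quotient_one quotient_inv quotient_mul.
Proof. by elim/quotW=> x; rewrite quotient_inv_pi quotient_mul_pi mulVg. Qed.

Let quotient_mulrV : right_inverse quotient_one quotient_inv quotient_mul.
Proof. by elim/quotW=> x; rewrite quotient_inv_pi quotient_mul_pi mulgV. Qed.

HB.instance Definition _ := isGroup.Build quotient
  quotient_mulA quotient_mul1 quotient_mulr1 quotient_mulV quotient_mulrV.

End Quotient.

Definition abelian_by_nilpotent (G : groupType) :=
  exists N : normalClosed G, abelian N /\ nilpotent (@predT (quotient N)).

Definition nilpotent_by_abelian (G : groupType) :=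
  exists N : normalClosed G, nilpotent N /\ abelian (@predT (quotient N)).

HB.mixin Record isSkewBrace A of Choice A := {
  sb_zero : A;
  sb_opp : A -> A;
  sb_add : A -> A -> A;
  sb_addA : associative sb_add;
  sb_add0 : left_id sb_zero sb_add;
  sb_addr0 : right_id sb_zero sb_add;
  sb_addN : left_inverse sb_zero sb_opp sb_add;
  sb_addrN : right_inverse sb_zero sb_opp sb_add;
  sb_one : A;
  sb_inv : A -> A;
  sb_circ : A -> A -> A;
  sb_circA : associative sb_circ;
  sb_circ1 : left_id sb_one sb_circ;
  sb_circr1 : right_id sb_one sb_circ;
  sb_circV : left_inverse sb_one sb_inv sb_circ;
  sb_circrV : right_inverse sb_one sb_inv sb_circ;
  sb_circDr : forall a b c : A,
    sb_circ a (sb_add b c) =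
    sb_add (sb_add (sb_circ a b) (sb_opp a)) (sb_circ a c)
}.

#[short(type="skewBraceType")]
HB.structure Definition SkewBrace := {A of isSkewBrace A & Choice A}.

Definition two_sided (A : skewBraceType) := forall a b c : A,
  sb_circ (sb_add a b) c =
  sb_add (sb_add (sb_circ a c) (sb_opp c)) (sb_circ b c).

(* Aliases of the carrier, so that each of the two group laws of a skew brace
   gets its own [groupType] instance; [*] on [additive_group A] is [sb_add]. *)
Definition additive_group (A : skewBraceType) : Type := A.
Definition multiplicative_group (A : skewBraceType) : Type := A.

HB.instance Definition _ (A : skewBraceType) := Choice.on (additive_group A).
HB.instance Definition _ (A : skewBraceType) :=
  isGroup.Build (additive_group A) (@sb_addA A) (@sb_add0 A) (@sb_addr0 A)
    (@sb_addN A) (@sb_addrN A).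

HB.instance Definition _ (A : skewBraceType) :=
  Choice.on (multiplicative_group A).
HB.instance Definition _ (A : skewBraceType) :=
  isGroup.Build (multiplicative_group A) (@sb_circA A) (@sb_circ1 A)
    (@sb_circr1 A) (@sb_circV A) (@sb_circrV A).

(* Main.v *)
(** Write [a * b = - a + a \circ b - b] and [a *' b = - b + a \circ b - a], and
    let [A^2] and [A_op^2] be the additive subgroups generated by the elements
    [a * b] and [a *' b]; both are normal in [(A, +)].  Expanding
    [(a + b) \circ (c + d)] in two ways shows that [A^2] and [A_op^2] centralize
    each other, so [I = A^2 \cap A_op^2] is abelian.  Modulo [A^2] the
    operation [\circ] is [+], and modulo [A_op^2] it is the opposite of [+];
    hence both additive quotients are nilpotent, so [(A / I, +)] is nilpotent.
    The centralizer [C] of [I] contains [A^2] and [A_op^2], so [A / C] is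
    abelian; and a term of the lower central series of [C] lies in [I], so the
    next one is trivial. *)
Require Import Defs.
From HB Require Import structures.
From mathcomp Require Import all_boot boolp.

Set Implicit Arguments.
Unset Strict Implicit.
Unset Printing Implicit Defensive.

Local Open Scope group_scope.
Local Open Scope quotient_scope.

(** Allows a predicate built inside a proof to serve as a [groupClosed], as the induction principle
    below requires. *)
Definition pack_groupClosed (G : groupType) (S : {pred G})
    (clS : group_closed S) : groupClosed G :=
  HB.pack S (isInvClosed.Build G S (group_closedV clS))
    (isMul1Closed.Build G S clS.1) (isMulClosed.Build G S (group_closedM clS)).

(** * Generated subgroups, commutators and centralizers *)

Section Generated.
Variable G : groupType.
Implicit Types (S T H K : {pred G}) (P : G -> Prop).

Lemma sub_generated S : {subset S <= generated S}.
Proof. by move=> x Sx; apply/asboolP => K; apply. Qed.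

Lemma generated_group_closed S : group_closed (generated S).
Proof.
split=> [|x y /asboolP Sx /asboolP Sy]; apply/asboolP => K SK.
  exact: gpred1.
by rewrite gpredF ?Sx ?Sy.
Qed.

HB.instance Definition _ S :=
  GroupClosed.copy (generated S) (pack_groupClosed (generated_group_closed S)).

Lemma generated1 S : 1 \in generated S.
Proof. by have [] := generated_group_closed S. Qed.

(** The elements satisfying [P] form a subgroup containing [S], one of those intersected in
    [generated S]. *)
Lemma generated_ind S P :
    P 1 -> (forall x, P x -> P x^-1) -> (forall x y, P x -> P y -> P (x * y)) ->
    (forall x, x \in S -> P x) ->
  forall x, x \in generated S -> P x.
Proof.
move=> P1 PV PM PS; pose K : {pred G} := [pred x | `[< P x >]].
have clK : group_closed K.
  by split=> [|x y /asboolP Px /asboolP Py]; apply/asboolP => //; apply/PM/PV.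
move=> x /asboolP/(_ (pack_groupClosed clK)) Kx; apply/asboolP/Kx => y Sy.
exact/asboolP/PS.
Qed.

(** Conjugation is a homomorphism, so normality can be tested on generators. *)
Lemma generated_conj S :
    (forall x g, x \in S -> x ^ g \in generated S) ->
  forall x g, x \in generated S -> x ^ g \in generated S.
Proof.
move=> SJ x g; elim/generated_ind=> {x} [|x Sx|x y Sx Sy|x /SJ//].
- by rewrite conj1g generated1.
- by rewrite conjVg gpredV.
- by rewrite conjMg gpredM.
Qed.

Lemma generated_commute S T :
    (forall x y, x \in S -> y \in T -> commute x y) ->
  forall x y, x \in generated S -> y \in generated T -> commute x y.
Proof.
move=> ST x y Sx Ty; elim/generated_ind: x / Sx => [|x xy|x z xy zy|x Sx].
- exact/commute_sym/commute1.
- exact/commute_sym/commuteV/commute_sym.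
- by apply/commute_sym/commuteM; apply/commute_sym.
elim/generated_ind: y / Ty => [|y xy|y z xy xz|y Ty].
- exact: commute1.
- exact: commuteV.
- exact: commuteM.
- exact: ST.
Qed.

Lemma mem_commutator S H x y :
  x \in S -> y \in H -> [~ x, y] \in commutator S H.
Proof. by move=> Sx Hy; apply/sub_generated/asboolP; exists x, y. Qed.

Lemma commutator_ind S H P :
    P 1 -> (forall x, P x -> P x^-1) -> (forall x y, P x -> P y -> P (x * y)) ->
    (forall x y, x \in S -> y \in H -> P [~ x, y]) ->
  forall x, x \in commutator S H -> P x.
Proof.
move=> P1 PV PM PR; apply: generated_ind => // _ /asboolP[x [y [Sx Hy ->]]].
exact: PR.
Qed.

Lemma lower_centralS H K n :
  {subset H <= K} -> {subset lower_central H n <= lower_central K n}.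
Proof.
move=> HK; elim: n => [//|n IHn] x /=; elim/commutator_ind=> {x}.
- exact: generated1.
- by move=> x; rewrite gpredV.
- by move=> x y; apply: gpredM.
- by move=> x y /IHn ? /HK; apply: mem_commutator.
Qed.

Definition centralizer S : {pred G} :=
  [pred x | `[< forall z, z \in S -> commute x z >]].

Lemma centralizer_group_closed S : group_closed (centralizer S).
Proof.
split=> [|x y /asboolP Cx /asboolP Cy]; apply/asboolP => z Sz.
  exact/commute_sym/commute1.
apply/commute_sym/commuteM; first exact/commute_sym/Cx.
exact/commuteV/commute_sym/Cy.
Qed.

HB.instance Definition _ S := GroupClosed.copy (centralizer S)
  (pack_groupClosed (centralizer_group_closed S)).

(** Term [n] of the lower central series of the centralizer lies in [S], so its elements commute
    with the whole centralizer and term [n.+1] is trivial. *)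
Lemma nilpotent_centralizer S n :
  {subset lower_central (@predT G) n <= S} -> nilpotent (centralizer S).
Proof.
move=> subS; exists n.+1 => x /=; elim/commutator_ind=> {x}.
- by rewrite !inE.
- by move=> x /eqP->; rewrite invg1 !inE.
- by move=> x y /eqP-> /eqP->; rewrite mulg1 !inE.
move=> x y Cx /asboolP Cy; apply/commgP/commute_sym/Cy/subS.
exact: lower_centralS Cx.
Qed.

End Generated.

(** * Intersections and centralizers of normal subgroups *)

Section NormalSubgroups.
Variable G : groupType.
Implicit Types M N : normalClosed G.

Definition intersection M N : {pred G} := [predI M & N].

Lemma intersection_group_closed M N : group_closed (intersection M N).
Proof.
split=> [|x y /andP[Mx Nx] /andP[My Ny]]; apply/andP.
  by split; apply: gpred1.
by split; apply: gpredF.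
Qed.

Lemma intersection_conj M N x g :
  x \in intersection M N -> x ^ g \in intersection M N.
Proof. by case/andP=> Mx Nx; apply/andP; split; apply: gpredJr. Qed.

HB.instance Definition _ M N := GroupClosed.copy (intersection M N)
  (pack_groupClosed (intersection_group_closed M N)).
HB.instance Definition _ M N :=
  isNormalClosed.Build G (intersection M N) (@intersection_conj M N).

Lemma centralizer_conj N x g : x \in centralizer N -> x ^ g \in centralizer N.
Proof.
(* Writes [z] as the conjugate by [g] of an element that normality keeps in [N]. *)
move=> /asboolP Cx; apply/asboolP => z Nz; rewrite -[z](conjgKV g).
by rewrite /commute -!conjMg Cx// gpredJr.
Qed.

HB.instance Definition _ N :=
  isNormalClosed.Build G (centralizer N) (@centralizer_conj N).

End NormalSubgroups.

(** * Lower central series under homomorphisms *)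

Section Morphisms.
Variables (G H : groupType) (f : G -> H).
Hypothesis fM : {morph f : x y / x * y}.

Let f1 : f 1 = 1.
Proof. by apply: (mulgI (f 1)); rewrite -fM !mulg1. Qed.

Let fV : {morph f : x / x^-1}.
Proof. by move=> x; apply: (mulgI (f x)); rewrite -fM !mulgV. Qed.

Let fR : {morph f : x y / [~ x, y]}.
Proof. by move=> x y; rewrite /commg /conjg !(fM, fV). Qed.

Lemma lower_central_morph n x :
  x \in lower_central predT n -> f x \in lower_central predT n.
Proof.
elim: n x => [//|n IHn] x /=; elim/commutator_ind=> {x}.
- by rewrite f1 generated1.
- by move=> x; rewrite fV gpredV.
- by move=> x y; rewrite fM; apply: gpredM.
- by move=> x y /IHn ? _; rewrite fR mem_commutator.
Qed.

Hypothesis f_surj : forall y, exists x, f x = y.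

(** A generating commutator lifts entry by entry: the first by induction, the second by
    surjectivity. *)
Lemma lower_central_surj n y : y \in lower_central predT n ->
  exists2 x, x \in lower_central predT n & f x = y.
Proof.
elim: n y => [|n IHn] y /=; first by have [x] := f_surj y; exists x.
elim/commutator_ind=> {y}
  [|_ [x ? <-]|_ _ [x ? <-] [y ? <-]|x y /IHn[u ? <-] _].
- by exists 1; rewrite ?gpred1.
- by exists x^-1; rewrite ?gpredV.
- by exists (x * y); rewrite ?gpredM.
- by have [v <-] := f_surj y; exists [~ u, v]; rewrite ?mem_commutator.
Qed.

Lemma nilpotent_surj : nilpotent (@predT G) -> nilpotent (@predT H).
Proof.
move=> [n nilG]; exists n => y /lower_central_surj[x /nilG/eqP-> <-].
by rewrite f1 !inE.
Qed.

End Morphisms.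

(** * Nilpotency of quotients *)

Section QuotientNilpotent.
Variables (G : groupType) (N : normalClosed G).

Definition quotient_map (x : G) : quotient N := \pi x.

Lemma quotient_mapM : {morph quotient_map : x y / x * y}.
Proof. by move=> x y; rewrite /quotient_map -quotient_mul_pi. Qed.

Lemma quotient_map_surj u : exists x, quotient_map x = u.
Proof. by exists (repr u); apply: reprK. Qed.

Lemma quotient_map_eqP x y :
  reflect (quotient_map x = quotient_map y) (x^-1 * y \in N).
Proof. exact: quotient_piP. Qed.

Lemma quotient_map_eq1 x : (quotient_map x == 1) = (x \in N).
Proof.
by rewrite -(gpredV N x) -[x^-1]mulg1; apply/eqP/idP => /quotient_map_eqP.
Qed.

Lemma nilpotent_quotientP : nilpotent (@predT (quotient N)) <->
  exists n, {subset lower_central (@predT G) n <= N}.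
Proof.
split=> -[n sub]; exists n => x.
  move/(lower_central_morph quotient_mapM)/sub.
  by rewrite !inE quotient_map_eq1.
case/(lower_central_surj quotient_mapM quotient_map_surj) => y /sub Ny <-.
by rewrite !inE quotient_map_eq1.
Qed.

End QuotientNilpotent.

(** Serves to bring the nilpotency bounds of two different quotients to a common index. *)
Lemma lower_central_predT_leq (G : groupType) m n : m <= n ->
  {subset lower_central (@predT G) n <= lower_central predT m}.
Proof.
have lcS k : {subset lower_central (@predT G) k.+1 <= lower_central predT k}.
  elim: k => [//|k IHk] x; elim/commutator_ind=> {x}.
  - exact: generated1.
  - by move=> x; rewrite gpredV.
  - by move=> x y; apply: gpredM.
  - by move=> x y /IHk ? _; apply: mem_commutator.
move=> /subnK <-; elim: (n - m) => [//|k IHk] x /lcS.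
exact: IHk.
Qed.

(** * The subgroups [square] and [op_square] of a skew brace *)

Section TwoSidedSkewBrace.
Variable A : skewBraceType.
Local Notation G := (additive_group A).
Implicit Types a b c d : G.

Let circ (a b : G) : G := sb_circ (a : A) b.

Let circDr a b c : circ a (b * c) = circ a b * a^-1 * circ a c.
Proof. exact: sb_circDr. Qed.

Definition star a b : G := a^-1 * circ a b * b^-1.
(** This is [star] computed in the skew brace with the opposite addition. *)
Definition op_star a b : G := b^-1 * circ a b * a^-1.

Definition square : {pred G} :=
  generated [pred z | `[< exists a b, z = star a b >]].
Definition op_square : {pred G} :=
  generated [pred z | `[< exists a b, z = op_star a b >]].

HB.instance Definition _ := GroupClosed.on square.
HB.instance Definition _ := GroupClosed.on op_square.

Lemma mem_square a b : star a b \in square.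
Proof. by apply/sub_generated/asboolP; exists a, b. Qed.

Lemma mem_op_square a b : op_star a b \in op_square.
Proof. by apply/sub_generated/asboolP; exists a, b. Qed.

Lemma square_conj x g : x \in square -> x ^ g \in square.
Proof.
apply: generated_conj => {}x {}g /asboolP[a [b ->]].
(* Solves [star a (b * c) = star a b * star a c ^ b^-1] for the conjugate, with [g^-1] and [b] in
   place of [b] and [c]. *)
suff -> : star a b ^ g = (star a g^-1)^-1 * star a (g^-1 * b).
  by rewrite gpredM ?gpredV ?mem_square.
by rewrite /star circDr /conjg !invgM !invgK !mulgA !(mulgK, mulgVK).
Qed.

Lemma op_square_conj x g : x \in op_square -> x ^ g \in op_square.
Proof.
apply: generated_conj => {}x {}g /asboolP[a [b ->]].
(* Comes from [op_star a (b * c) = op_star a b ^ c * op_star a c]. *)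
suff -> : op_star a b ^ g = op_star a (b * g) * (op_star a g)^-1.
  by rewrite gpredM ?gpredV ?mem_op_square.
by rewrite /op_star circDr /conjg !invgM !invgK !mulgA !(mulgK, mulgVK).
Qed.

HB.instance Definition _ := isNormalClosed.Build G square square_conj.
HB.instance Definition _ := isNormalClosed.Build G op_square op_square_conj.

Lemma circ_square a b : (circ a b)^-1 * (a * b) \in square.
Proof.
have -> : (circ a b)^-1 * (a * b) = (star a b)^-1 ^ b.
  by rewrite /star /conjg !invgM !invgK !mulgA mulVg mul1g.
by rewrite gpredJr // gpredV mem_square.
Qed.

Lemma circ_op_square a b : circ a b * (a^-1 * b^-1) \in op_square.
Proof.
have -> : circ a b * (a^-1 * b^-1) = op_star a b ^ b^-1.
  by rewrite /op_star /conjg !invgK !mulgA mulgV mul1g.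
by rewrite gpredJr // mem_op_square.
Qed.

Lemma nilpotent_square : nilpotent (@predT (multiplicative_group A)) ->
  nilpotent (@predT (quotient square)).
Proof.
apply: (@nilpotent_surj (multiplicative_group A) (quotient square)
  (@quotient_map G square)).
  move=> x y /=; rewrite -quotient_mapM; apply/quotient_map_eqP.
  exact: circ_square.
exact: quotient_map_surj.
Qed.

Lemma nilpotent_op_square : nilpotent (@predT (multiplicative_group A)) ->
  nilpotent (@predT (quotient op_square)).
Proof.
apply: (@nilpotent_surj (multiplicative_group A) (quotient op_square)
  (* Modulo [op_square] the projection reverses products; composing it with inversion gives a
     homomorphism. *)
  (fun x => @quotient_map G op_square (x : G)^-1)).
  move=> x y /=; rewrite -quotient_mapM; apply/quotient_map_eqP; rewrite invgK.
  exact: circ_op_square.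
move=> u; have [x <-] := quotient_map_surj u.
by exists x^-1; rewrite invgK.
Qed.

Definition core : {pred G} := intersection square op_square.

HB.instance Definition _ := NormalClosed.on core.

(** Stated inside the group rather than in the quotient, because the nilpotency of the centralizer
    of [core] relies on the same bound. *)
Lemma lower_central_core : nilpotent (@predT (multiplicative_group A)) ->
  exists n, {subset lower_central (@predT G) n <= core}.
Proof.
move=> nilA; have /nilpotent_quotientP[m subm] := nilpotent_square nilA.
have /nilpotent_quotientP[n subn] := nilpotent_op_square nilA.
exists (maxn m n) => x lcx; apply/andP; split.
  exact/subm/(lower_central_predT_leq (leq_maxl m n)).
exact/subn/(lower_central_predT_leq (leq_maxr m n)).
Qed.

Hypothesis two_sidedA : two_sided A.

Let circDl a b c : circ (a * b) c = circ a c * c^-1 * circ b c.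
Proof. exact: two_sidedA. Qed.

Lemma star_commute a b c d : commute (star a d) (op_star b c).
Proof.
(* The left side is then expanded by [circDr] first, the right side by [circDl] first. *)
have: circ (a * b) (c * d) = circ (a * b) (c * d) by [].
rewrite {1}circDr !circDl !circDr => eq_abcd.
(* Both expansions begin with [circ a c] and end with [circ b d]; what lies between is the two
   products of [star a d] and [op_star b c]. *)
apply: (mulgI (circ a c)); apply: (mulIg (circ b d)).
by rewrite /star /op_star; move: eq_abcd; rewrite !invgM !mulgA => ->.
Qed.

Lemma square_commute x y : x \in square -> y \in op_square -> commute x y.
Proof.
apply: generated_commute => {}x {}y /asboolP[a [d ->]] /asboolP[b [c ->]].
exact: star_commute.
Qed.

Lemma core_abelian : abelian core.
Proof. by move=> x y /andP[Sx _] /andP[_ Sy]; apply: square_commute. Qed.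

Lemma quotient_centralizer_core_abelian :
  abelian (@predT (quotient (centralizer core))).
Proof.
have sC x : x \in square -> x \in centralizer core.
  by move=> Sx; apply/asboolP => z /andP[_]; apply: square_commute.
have oC x : x \in op_square -> x \in centralizer core.
  move=> Sx; apply/asboolP => z /andP[Sz _].
  exact/commute_sym/square_commute.
move=> u v _ _; have [x <-] := quotient_map_surj u.
have [y <-] := quotient_map_surj v.
rewrite -!quotient_mapM; apply/quotient_map_eqP; rewrite -gpredV.
(* The left side is [[~ x, y]]. Inserting [circ x y] between [(y * x)^-1] and [x * y] splits it into
   a factor in [op_square] up to conjugation and a factor in [square]. *)
suff -> : ((x * y)^-1 * (y * x))^-1 =
    (op_star x y) ^ x * ((circ x y)^-1 * (x * y)).
  by apply: gpredM; [apply/gpredJr/oC/mem_op_square | apply/sC/circ_square].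
by rewrite /op_star /conjg !invgM !invgK !mulgA !(mulgK, mulgVK).
Qed.

End TwoSidedSkewBrace.

Theorem theorem4p14 (A : skewBraceType) :
  two_sided A ->
  nilpotent (@predT (multiplicative_group A)) ->
  abelian_by_nilpotent (additive_group A) /\
  nilpotent_by_abelian (additive_group A).
Proof.
move=> two_sidedA nilA; have [n sub_core] := lower_central_core nilA; split.
  exists [the normalClosed _ of @core A]; split.
    exact: core_abelian two_sidedA.
  by apply/nilpotent_quotientP; exists n.
exists [the normalClosed _ of centralizer (@core A)]; split.
  exact: nilpotent_centralizer sub_core.
exact: quotient_centralizer_core_abelian two_sidedA.
Qed.
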